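(* Let $\Sigma$ be a set of symbols with arities $\mathsf{ar}(\sigma)\in\mathbb{N}$ for $\sigma\in\Sigma$, and let $F:\mathsf{Set}\to\mathsf{Set}$ be the polynomial functor $FX=\sum_{\sigma\in\Sigma}X^{\mathsf{ar}(\sigma)}$. (i) Let $b:B\to FB$ be a coalgebra. Regard both $B$ and $FB$ as subsets of $T^\Sigma(B)$, via $\mathsf{in}:B\to T^\Sigma(B)$ and $\alpha\circ F\mathsf{in}:FB\to T^\Sigma(B)$. Let $\approx_b$ be the congruence on $T^\Sigma(B)$ generated by $\{x\approx b(x)\mid x\in B\}$. Then the relatively initial algebra $\mu(b)$ is given by the quotient algebra $T^\Sigma(B)/{\approx_b}$. (ii) Let $a:FA\to A$ be an $F$-algebra. Then the relatively terminal coalgebra $\nu(a)$ is given by the subcoalgebra $$\{t\in C^\Sigma(A)\mid \text{every node } u \text{ of } t \text{ is } a\text{-guided}\}$$ of $C^\Sigma(A)$.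
   Context: A $\Sigma$-branching tree is a tree in which each node $u$ (other than variable leaves, when present) comes with a chosen $\sigma_u\in\Sigma$ and has an ordered list of exactly $\mathsf{ar}(\sigma_u)$ children. $T^\Sigma(X)$, the free $F$-algebra on $X$, is the algebra of finite $\Sigma$-branching trees with leaves labeled by elements of $X$, i.e. the algebra of $\Sigma$-terms over $X$; $\mathsf{in}:X\to T^\Sigma(X)$ is the inclusion of variables and $\alpha:FT^\Sigma(X)\to T^\Sigma(X)$ its algebra structure. $C^\Sigma(X)$, the cofree $F$-coalgebra on $X$, is the coalgebra of finite and infinite $\Sigma$-branching trees in which each node carries a symbol of $\Sigma$ and a label in $X$; its structure map sends a tree with root symbol $\sigma$ to $\sigma(t_1,\dots,t_{\mathsf{ar}(\sigma)})$, where the $t_i$ are the immediate subtrees. For $t\in C^\Sigma(A)$, let $u$ be a node of $t$ with label $x\in A$, symbol $\sigma$ of arity $k$, and children $v_1,\dots,v_k$ labeled $y_1,\dots,y_k\in A$. The node $u$ is $a$-guided if $a(\sigma(y_1,\dots,y_k))=x$. For a coalgebra $b:B\to FB$ and an algebra $a:FA\to A$, $\mathsf{CA}_F(b,a)$ is the set of ca-morphisms, i.e. maps $f:B\to A$ with $f=a\circ Ff\circ b$, functorial in $b$ and $a$ by composition. $\mu(b)$ is the (unique up to unique isomorphism) algebra with a natural isomorphism $\mathsf{Alg}_F(\mu(b),-)\cong\mathsf{CA}_F(b,-)$, and $\nu(a)$ is the (unique up to unique isomorphism) coalgebra with a natural isomorphism $\mathsf{Coalg}_F(-,\nu(a))\cong\mathsf{CA}_F(-,a)$.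 *)

(* Defs.v *)
From HB Require Import structures.
From mathcomp Require Import all_boot.
From mathcomp Require Import generic_quotient boolp.

Set Implicit Arguments.
Unset Strict Implicit.
Unset Printing Implicit Defensive.

Section Polynomial.
Variables (Sigma : Type) (ar : Sigma -> nat).

Definition polyF (X : Type) : Type := {s : Sigma & 'I_(ar s) -> X}.

Definition polyF_map (X Y : Type) (f : X -> Y) (u : polyF X) : polyF Y :=
  existT (fun s => 'I_(ar s) -> Y) (projT1 u) (f \o projT2 u).

Record algebra := Algebra {
  alg_carrier :> Type;
  alg_op : polyF alg_carrier -> alg_carrier }.

Record coalgebra := Coalgebra {
  coalg_carrier :> Type;
  coalg_op : coalg_carrier -> polyF coalg_carrier }.

Definition is_alg_hom (A A' : algebra) (h : A -> A') : Prop :=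
  h \o @alg_op A = @alg_op A' \o polyF_map h.

Definition is_coalg_hom (B B' : coalgebra) (g : B -> B') : Prop :=
  polyF_map g \o @coalg_op B = @coalg_op B' \o g.

Definition is_ca_morphism (B : coalgebra) (A : algebra) (f : B -> A) : Prop :=
  f = @alg_op A \o polyF_map f \o @coalg_op B.

Definition Alg (A A' : algebra) : Type := {h : A -> A' | is_alg_hom h}.
Definition Coalg (B B' : coalgebra) : Type := {g : B -> B' | is_coalg_hom g}.
Definition CA (B : coalgebra) (A : algebra) : Type :=
  {f : B -> A | is_ca_morphism f}.

Lemma is_alg_hom_comp (A A' A'' : algebra) (g : A' -> A'') (h : A -> A') :
  is_alg_hom g -> is_alg_hom h -> is_alg_hom (g \o h).
Proof.
move=> hg hh; apply/funext => u /=.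
have /= -> := congr1 (@^~ u) hh.
exact: (congr1 (@^~ (polyF_map h u)) hg).
Qed.

Lemma is_coalg_hom_comp (B B' B'' : coalgebra) (g : B' -> B'') (h : B -> B') :
  is_coalg_hom g -> is_coalg_hom h -> is_coalg_hom (g \o h).
Proof.
move=> hg hh; apply/funext => u /=.
have /= <- := congr1 (@^~ (h u)) hg.
by have /= <- := congr1 (@^~ u) hh.
Qed.

Lemma is_ca_morphism_post (B : coalgebra) (A A' : algebra)
    (g : A -> A') (f : B -> A) :
  is_alg_hom g -> is_ca_morphism f -> is_ca_morphism (g \o f).
Proof.
move=> hg hf; apply/funext => u /=.
have /= -> := congr1 (@^~ u) hf.
exact: (congr1 (@^~ (polyF_map f (coalg_op u))) hg).
Qed.

Lemma is_ca_morphism_pre (B B' : coalgebra) (A : algebra)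
    (f : B -> A) (g : B' -> B) :
  is_ca_morphism f -> is_coalg_hom g -> is_ca_morphism (f \o g).
Proof.
move=> hf hg; apply/funext => u /=.
have /= -> := congr1 (@^~ (g u)) hf.
by have /= <- := congr1 (@^~ u) hg.
Qed.

Definition Alg_comp (A A' A'' : algebra) (g : Alg A' A'') (h : Alg A A') :
    Alg A A'' :=
  exist _ (sval g \o sval h) (is_alg_hom_comp (svalP g) (svalP h)).

Definition Coalg_comp (B B' B'' : coalgebra)
    (g : Coalg B' B'') (h : Coalg B B') : Coalg B B'' :=
  exist _ (sval g \o sval h) (is_coalg_hom_comp (svalP g) (svalP h)).

Definition CA_post (B : coalgebra) (A A' : algebra)
    (g : Alg A A') (f : CA B A) : CA B A' :=
  exist _ (sval g \o sval f) (is_ca_morphism_post (svalP g) (svalP f)).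

Definition CA_pre (B B' : coalgebra) (A : algebra)
    (f : CA B A) (g : Coalg B' B) : CA B' A :=
  exist _ (sval f \o sval g) (is_ca_morphism_pre (svalP f) (svalP g)).

(* M is mu(b): Alg(M, -) and CA(b, -) are naturally isomorphic functors. *)
Definition relatively_initial (B : coalgebra) (M : algebra) : Prop :=
  exists phi : forall A : algebra, Alg M A -> CA B A,
    (forall A, bijective (phi A)) /\
    (forall (A A' : algebra) (g : Alg A A') (h : Alg M A),
       phi A' (Alg_comp g h) = CA_post g (phi A h)).

(* N is nu(a): Coalg(-, N) and CA(-, a) are naturally isomorphic functors. *)
Definition relatively_terminal (A : algebra) (N : coalgebra) : Prop :=
  exists psi : forall B : coalgebra, Coalg B N -> CA B A,
    (forall B, bijective (psi B)) /\
    (forall (B B' : coalgebra) (g : Coalg B' B) (h : Coalg B N),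
       psi B' (Coalg_comp h g) = CA_pre (psi B h) g).

Inductive term (X : Type) : Type :=
| Var of X
| Op (s : Sigma) of ('I_(ar s) -> term X).

Definition term_alg (X : Type) : algebra :=
  @Algebra (term X) (fun u => Op (projT2 u)).

Inductive gen_congruence (A : algebra) (R : A -> A -> Prop) : A -> A -> Prop :=
| gcong_base x y : R x y -> gen_congruence R x y
| gcong_refl x : gen_congruence R x x
| gcong_sym x y : gen_congruence R x y -> gen_congruence R y x
| gcong_trans y x z :
    gen_congruence R x y -> gen_congruence R y z -> gen_congruence R x z
| gcong_op (s : Sigma) (xs ys : 'I_(ar s) -> A) :
    (forall i, gen_congruence R (xs i) (ys i)) ->
    gen_congruence R (alg_op (existT _ s xs)) (alg_op (existT _ s ys)).

(* [Var] is the inclusion of B and [alg_op \o polyF_map Var] that of F B. *)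
Inductive coalg_eqn (B : coalgebra) : term_alg B -> term_alg B -> Prop :=
| CoalgEqn (x : B) :
    coalg_eqn (Var x) (@alg_op (term_alg B) (polyF_map (@Var B) (coalg_op x))).

Definition approx (B : coalgebra) : term_alg B -> term_alg B -> Prop :=
  gen_congruence (@coalg_eqn B).

Section Quotient.
Variable B : coalgebra.

Definition approxb : rel {classic term B} := fun t u => `[< approx t u >].

Lemma approxb_refl : reflexive approxb.
Proof. by move=> t; apply/asboolP; exact: gcong_refl. Qed.

Lemma approxb_sym : symmetric approxb.
Proof. by move=> t u; apply/asboolP/asboolP; exact: gcong_sym. Qed.

Lemma approxb_trans : transitive approxb.
Proof.
move=> u t v /asboolP tu /asboolP uv; apply/asboolP.
exact: gcong_trans tu uv.
Qed.

Canonical approx_equiv :=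
  EquivRel approxb approxb_refl approxb_sym approxb_trans.

Definition term_quot : Type := {eq_quot approx_equiv}%qT.

Definition term_class (t : term B) : term_quot :=
  (\pi_{eq_quot approx_equiv}%qT (t : {classic term B}))%qT.

End Quotient.

(* A finite or infinite branching tree with labels in X, as a partial map from
   addresses (sequences of child indices, read from the root) to pairs of a
   symbol and a label; it is defined exactly at the nodes of the tree. *)
Record tree (X : Type) : Type := Tree {
  tree_node :> seq nat -> option (Sigma * X);
  tree_root : tree_node [::];
  tree_children : forall p i,
    isSome (tree_node (rcons p i)) =
      if tree_node p is Some (s, _) then i < ar s else false }.

Section Cofree.
Variable X : Type.

Definition root_symbol (t : tree X) : Sigma :=
  match tree_node t [::] as o return isSome o -> Sigma with
  | Some r => fun _ => r.1
  | None => fun no => False_rect Sigma (notF no)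
  end (tree_root t).

Lemma root_symbolP (t : tree X) :
  exists x, tree_node t [::] = Some (root_symbol t, x).
Proof.
rewrite /root_symbol; move: (tree_root t).
by case: (tree_node t [::]) => [[s x]|] //= _; exists x.
Qed.

Lemma subtree_root (t : tree X) (i : 'I_(ar (root_symbol t))) :
  tree_node t [:: val i].
Proof.
have [x tx] := root_symbolP t.
by rewrite -[[:: _]]/(rcons [::] (val i)) tree_children tx ltn_ord.
Qed.

Definition subtree (t : tree X) (i : 'I_(ar (root_symbol t))) : tree X :=
  @Tree X (fun p => tree_node t (val i :: p)) (subtree_root i)
    (fun p => tree_children t (val i :: p)).

Definition cofree_coalg : coalgebra :=
  @Coalgebra (tree X) (fun t => existT _ (root_symbol t) (@subtree t)).

End Cofree.

Definition guided_at (A : algebra) (t : tree A) (p : seq nat) : Prop :=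
  forall (s : Sigma) (x : A), tree_node t p = Some (s, x) ->
    exists2 ys : 'I_(ar s) -> A,
      forall i : 'I_(ar s),
        omap snd (tree_node t (rcons p (val i))) = Some (ys i) &
      alg_op (existT _ s ys) = x.

Definition guided_tree (A : algebra) : Type :=
  {t : tree A | forall p, guided_at t p}.

End Polynomial.

Arguments Var {Sigma ar X} _.

(* Main.v *)
(** For (i), a ca-morphism [f] from [b] to [a] is a valuation of the variables
    whose evaluation map from terms to the algebra identifies each [x] with
    [b x]; it thus factors, uniquely, through the quotient by the generated
    congruence.  For (ii), a coalgebra map into the cofree coalgebra amounts to
    a labelling [f] of the coalgebra, namely the labels of the roots, and the
    unfoldings are guided at all nodes exactly when [f] is a ca-morphism. *)

From mathcomp Require Import all_boot.
From mathcomp Require Import generic_quotient boolp.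
Require Import Defs.

Set Implicit Arguments.
Unset Strict Implicit.
Unset Printing Implicit Defensive.

(** * The quotient term algebra as relatively initial algebra *)

Section Initial.
Variables (Sigma : Type) (ar : Sigma -> nat).

Fixpoint eval (X : Type) (A : algebra ar) (f : X -> A) (t : term ar X) : A :=
  match t with
  | Var x => f x
  | Op s ts => alg_op (existT _ s (fun i => eval f (ts i)))
  end.

Lemma alg_homE (A A' : algebra ar) (h : A -> A') (s : Sigma)
    (xs : 'I_(ar s) -> A) :
  is_alg_hom h ->
  h (alg_op (existT _ s xs)) = alg_op (existT _ s (h \o xs)).
Proof. by move=> hh; exact: (congr1 (@^~ (existT _ s xs : polyF ar A)) hh). Qed.

Lemma eval_unique (X : Type) (A : algebra ar) (h : term_alg ar X -> A) :
  is_alg_hom h -> h =1 eval (h \o Var).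
Proof.
move=> hh; elim=> [//|s ts IH] /=.
rewrite -[Op ts]/(alg_op (existT _ s ts : polyF ar (term_alg ar X))).
rewrite (alg_homE _ hh); congr (alg_op (existT _ s _)).
exact/funext.
Qed.

Variable B : coalgebra ar.

Lemma term_classP (t u : term ar B) :
  term_class t = term_class u <-> approx t u.
Proof.
split=> [/eqquotP/asboolP //|tu].
by apply/eqquotP/asboolP.
Qed.

Definition term_rep (x : term_quot B) : term ar B := repr x.

Lemma term_repK : cancel term_rep (@term_class _ ar B).
Proof. exact: reprK. Qed.

(** Arguments are replaced by chosen representatives; [term_class_hom] shows that the choice is
    immaterial. *)
Definition term_quot_op (u : polyF ar (term_quot B)) : term_quot B :=
  term_class (Op (term_rep \o projT2 u)).

Lemma term_class_hom :
  is_alg_hom (A := term_alg ar B) (A' := Algebra term_quot_op)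
    (@term_class _ ar B).
Proof.
apply/funext => -[s ts]; apply/term_classP.
apply: (@gcong_op _ ar (term_alg ar B) _ s ts
  (term_rep \o (@term_class _ ar B \o ts))) => i.
by apply/term_classP; rewrite /= term_repK.
Qed.

(** The kernel of evaluation is a congruence, and the ca equation for [f] says exactly that it
    contains the generating pairs. *)
Lemma eval_approx (A : algebra ar) (f : B -> A) (t u : term ar B) :
  is_ca_morphism f -> approx t u -> eval f t = eval f u.
Proof.
move=> hf; elim=> {t u} [_ _ [x]|//|//|t v u _ -> //|s ts us _ IH] /=.
  exact: (congr1 (@^~ x) hf).
by congr (alg_op (existT _ s _)); apply/funext.
Qed.

Lemma term_class_Var_ca :
  is_ca_morphism (B := B) (A := Algebra term_quot_op) (@term_class _ ar B \o Var).
Proof.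
apply/funext => x /=.
have /term_classP -> : approx (Var x) (Op (Var \o projT2 (coalg_op x))).
  by apply: gcong_base; exact: CoalgEqn.
exact: (congr1 (@^~ (polyF_map Var (coalg_op x))) term_class_hom).
Qed.

Lemma eval_term_rep_hom (A : algebra ar) (f : B -> A) :
  is_ca_morphism f ->
  is_alg_hom (A := Algebra term_quot_op) (eval f \o term_rep).
Proof.
move=> hf; apply/funext => -[s xs] /=.
rewrite -[RHS]/(eval f (Op (term_rep \o xs))).
by apply: eval_approx hf _; apply/term_classP; rewrite term_repK.
Qed.

Lemma term_quot_initial : relatively_initial B (Algebra term_quot_op).
Proof.
(* As in the Yoneda lemma, the isomorphism is composition with the universal element [eta], so
   naturality is associativity of composition. *)
pose eta : CA B (Algebra term_quot_op) := exist _ _ term_class_Var_ca.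
exists (fun A h => CA_post h eta); split=> [A|A A' g h]; last first.
  exact: eq_exist.
exists (fun f => exist _ _ (eval_term_rep_hom (svalP f))) => [[h hh]|[f hf]].
  apply: eq_exist; apply/funext => x /=.
  (* Composed with the class map, [h] is a homomorphism on terms, hence determined by its values at
     variables. *)
  have /eval_unique hE := is_alg_hom_comp hh term_class_hom.
  by rewrite -{2}(term_repK x) [RHS]hE.
apply: eq_exist; apply/funext => x /=.
by rewrite (@eval_approx _ f _ (Var x) hf) //; apply/term_classP; rewrite term_repK.
Qed.

End Initial.

(** * Guided trees as relatively terminal coalgebra *)

Section Terminal.
Variables (Sigma : Type) (ar : Sigma -> nat).

Lemma tree_ext (X : Type) (t u : tree ar X) :
  tree_node t =1 tree_node u -> t = u.
Proof.
case: t u => [t rt ct] [u ru cu] /= /funext tu; case: u / tu in ru cu *.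
by congr Tree; exact: Prop_irrelevance.
Qed.

Lemma tree_node_cat (X : Type) (t : tree ar X) (p q : seq nat) :
  tree_node t p = None -> tree_node t (p ++ q) = None.
Proof.
move=> tp; elim/last_ind: q => [|q i IH]; first by rewrite cats0.
have := tree_children t (p ++ q) i.
by rewrite -rcons_cat IH; case: (tree_node t _).
Qed.

(** The address entry [i] is a plain number and [u] is kept whole, so that an equation between
    dependent pairs can be rewritten without transporting indices along an equality of symbols. *)
Definition branch_node (X : Type) (u : polyF ar (tree ar X)) (i : nat)
    (p : seq nat) : option (Sigma * X) :=
  if insub i is Some j then tree_node (projT2 u j) p else None.

Lemma tree_node_cons (X : Type) (t : tree ar X) (i : nat) (p : seq nat) :
  tree_node t (i :: p) =
  branch_node (@coalg_op _ _ (cofree_coalg ar X) t) i p.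
Proof.
rewrite /branch_node /=; case: insubP => [j _ <- //|ige].
(* For [i] beyond the arity of the root, the child is absent, and so is everything below it. *)
apply: (@tree_node_cat _ t [:: i]).
have := tree_children t [::] i; have [x ->] := root_symbolP t.
by rewrite (negPf ige) /=; case: (tree_node t _).
Qed.

Definition root_label (X : Type) (t : tree ar X) : X :=
  match tree_node t [::] as o return isSome o -> X with
  | Some r => fun _ => r.2
  | None => fun no => False_rect X (notF no)
  end (tree_root t).

Lemma tree_node_root (X : Type) (t : tree ar X) :
  tree_node t [::] = Some (root_symbol t, root_label t).
Proof.
rewrite /root_symbol /root_label; move: (tree_root t).
by case: (tree_node t [::]) => [[s x]|].
Qed.

Section Unfold.
Variables (X : Type) (B : coalgebra ar) (f : B -> X).

Fixpoint unfold_node (b : B) (p : seq nat) : option (Sigma * X) :=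
  match p with
  | [::] => Some (projT1 (coalg_op b), f b)
  | i :: p' =>
    if insub i is Some j then unfold_node (projT2 (coalg_op b) j) p' else None
  end.

Lemma unfold_children (b : B) (p : seq nat) (i : nat) :
  isSome (unfold_node b (rcons p i)) =
    if unfold_node b p is Some (s, _) then i < ar s else false.
Proof.
elim: p b => [|k p IH] b /=; last by case: (insub k) => [j|//]; exact: IH.
by case: insubP => [j -> //|/negPf ->].
Qed.

Definition unfold_tree (b : B) : tree ar X :=
  @Tree _ ar X (unfold_node b) isT (unfold_children b).

Lemma subtree_unfold (b : B) (i : 'I_(ar (projT1 (coalg_op b)))) :
  @subtree _ _ _ (unfold_tree b) i = unfold_tree (projT2 (coalg_op b) i).
Proof. by apply: tree_ext => p /=; rewrite valK. Qed.

(** By induction on the address, for all states at once: the homomorphism equation fixes the root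
    symbol and moves to the children, while [f] fixes the labels. *)
Lemma unfold_tree_unique (h : B -> cofree_coalg ar X) :
  is_coalg_hom h -> @root_label X \o h = f -> h =1 unfold_tree.
Proof.
move=> hh hf b; apply: tree_ext => p; elim: p b => [|i p IH] b.
  rewrite tree_node_root /= -hf /=; congr (Some (_, _)).
  exact: (esym (congr1 (fun g => projT1 (g b)) hh)).
have hb : polyF_map h (coalg_op b) = @coalg_op _ _ (cofree_coalg ar X) (h b).
  exact: (congr1 (@^~ b) hh).
by rewrite tree_node_cons -hb /branch_node /=; case: insub.
Qed.

End Unfold.

Variable A : algebra ar.

Lemma subtree_guided (t : tree ar A) (gt : forall p, guided_at t p)
    (i : 'I_(ar (root_symbol t))) (p : seq nat) :
  guided_at (subtree i) p.
Proof. exact: gt (val i :: p). Qed.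

Definition guided_op (t : guided_tree A) : polyF ar (guided_tree A) :=
  existT _ (root_symbol (sval t))
    (fun i => exist _ (subtree i) (@subtree_guided _ (svalP t) i)).

Lemma guided_incl_hom :
  is_coalg_hom (B := Coalgebra guided_op) (B' := cofree_coalg ar A)
    (@proj1_sig _ _).
Proof. by []. Qed.

(** The ca equation at a tree is guidedness at its root, the labels [ys] being the root labels of
    the subtrees. *)
Lemma root_label_ca :
  is_ca_morphism (B := Coalgebra guided_op) (A := A)
    (@root_label A \o @proj1_sig _ _).
Proof.
apply/funext => -[t gt] /=.
have [ys tys <-] := gt _ _ _ (tree_node_root t).
rewrite /polyF_map /=; congr (alg_op (existT _ _ _)).
apply/funext => i /=; apply: Some_inj; rewrite -tys /=.
by rewrite -[tree_node t _]/(tree_node (subtree i) [::]) tree_node_root.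
Qed.

(** A node of an unfolding is the root of the unfolding of some later state, where guidedness is the
    ca equation for [f]. *)
Lemma unfold_guided (B : coalgebra ar) (f : B -> A) (hf : is_ca_morphism f)
    (b : B) (p : seq nat) :
  guided_at (unfold_tree f b) p.
Proof.
elim: p b => [|k p IH] b s x /=; last first.
  by case: (insub k) => [j|//]; exact: IH.
case=> <- <-; exists (f \o projT2 (coalg_op b)) => [i|]; first by rewrite valK.
exact: (esym (congr1 (@^~ b) hf)).
Qed.

Definition guided_unfold (B : coalgebra ar) (f : CA B A) (b : B) :
    guided_tree A :=
  exist _ (unfold_tree (sval f) b) (@unfold_guided _ _ (svalP f) b).

Lemma guided_unfold_hom (B : coalgebra ar) (f : CA B A) :
  is_coalg_hom (B' := Coalgebra guided_op) (guided_unfold f).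
Proof.
apply/funext => b /=; congr (existT _ (projT1 (coalg_op b)) _).
by apply/funext => i; apply: eq_exist; rewrite subtree_unfold.
Qed.

Lemma guided_tree_terminal : relatively_terminal A (Coalgebra guided_op).
Proof.
pose eps : CA (Coalgebra guided_op) A := exist _ _ root_label_ca.
exists (fun B h => CA_pre eps h); split=> [B|B B' g h]; last first.
  exact: eq_exist.
exists (fun f => exist _ _ (guided_unfold_hom f)) => [[h hh]|[f hf]].
  apply: eq_exist; apply/funext => b.
  apply: eq_sig_hprop => [t|/=]; first exact: Prop_irrelevance.
  apply/esym/(unfold_tree_unique (h := @proj1_sig _ _ \o h)) => //.
  exact: is_coalg_hom_comp guided_incl_hom hh.
(* The root label of the unfolding of [b] computes to [f b]. *)
by apply: eq_exist; apply/funext.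
Qed.

End Terminal.

Theorem proposition3p5 (Sigma : Type) (ar : Sigma -> nat) :
  (forall B : coalgebra ar,
     exists q : polyF ar (term_quot B) -> term_quot B,
       is_alg_hom (A := term_alg ar B) (A' := Algebra q) (@term_class _ ar B) /\
       relatively_initial B (Algebra q)) /\
  (forall A : algebra ar,
     exists n : guided_tree A -> polyF ar (guided_tree A),
       is_coalg_hom (B := Coalgebra n) (B' := cofree_coalg ar A) (@proj1_sig _ _) /\
       relatively_terminal A (Coalgebra n)).
Proof.
split=> [B|A].
  exists (@term_quot_op _ ar B); split.
    exact: term_class_hom.
  exact: term_quot_initial.
exists (@guided_op _ ar A); split; first exact: guided_incl_hom.
exact: guided_tree_terminal.
Qed.
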